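(* Let $m, n$ be arbitrary integers, and put $R = m^4 - 6m^2n^2 + n^4$, $D = m^{12} - 26m^{10}n^2 + 79m^8n^4 - 44m^6n^6 + 79m^4n^8 - 26m^2n^{10} + n^{12}$ and $E = m^{12} - 10m^{10}n^2 + 15m^8n^4 - 204m^6n^6 + 15m^4n^8 - 10m^2n^{10} + n^{12}$. For each of the following four triads $(a,b,c)$ of integers, all three of $a, b, c$ are perfect squares and $a+b+c$, $ab+bc+ca$ and $abc$ are all perfect squares: (1) $a = (m^4-n^4)^2R^2$, $b = 4m^2n^2(m^2+n^2)^2R^2$, $c = 64m^4n^4(m^2-n^2)^4$; (2) $a = 64m^4n^4(m^2-n^2)^2$, $b = 16m^2n^2(m^2-n^2)^4$, $c = (m^2+n^2)^2R^2$; (3) $a = 64m^4n^4(m^2-n^2)^2D^2$, $b = (m^2+n^2)^2R^2D^2$, $c = 16m^2n^2(m^2-n^2)^4E^2$; (4) $a = (m^4-n^4)^2R^2E^2$, $b = 64m^4n^4(m^2-n^2)^4E^2$, $c = 4m^2n^2(m^2+n^2)^2R^2D^2$.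
   Context: A perfect square is an integer of the form $k^2$ with $k$ an integer (so $0$ counts as a perfect square). *)

(* Defs.v *)
From Stdlib Require Import ZArith.
Local Open Scope Z_scope.

Definition perfect_square (x : Z) : Prop := exists k : Z, x = k ^ 2.

Definition square_triad (a b c : Z) : Prop :=
  (perfect_square a /\ perfect_square b /\ perfect_square c) /\
  (perfect_square (a + b + c) /\
   perfect_square (a * b + b * c + c * a) /\
   perfect_square (a * b * c)).

(* Main.v *)
(** Put P = m^2 - n^2, Q = 2mn, S = m^2 + n^2, so that P^2 + Q^2 = S^2, and
    U = P^2, V = Q^2.  Then R = U - V, D = U^3 - 5U^2V - UV^2 + V^3 and
    E = U^3 - U^2V - UV^2 - 3V^3, and the triads are the squares of
      (1) (PSR, QSR, 2P^2Q^2),        (2) (2PQ^2, 2P^2Q, SR),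
      (3) (2PQ^2D, SRD, 2P^2QE),      (4) (PSRE, 2P^2Q^2E, QSRD).
    Up to order, the roots in (1) and (4) are the pairwise products of those in
    (2) and (3), divided by 2PQ and 2PQD.  Taking pairwise products exchanges
    the conditions on a+b+c and ab+bc+ca, so the same factors U^2 + V^2
    (for (1), (2)) and F, G below (for (3), (4)) occur in the square roots of
    both members of a dual pair. *)

Require Import Defs.
From Stdlib Require Import ZArith.
Local Open Scope Z_scope.

Lemma square_triad_sqr (x y z s t a b c : Z) :
  a = x^2 -> b = y^2 -> c = z^2 ->
  x^2 + y^2 + z^2 = s^2 ->
  (x*y)^2 + (y*z)^2 + (z*x)^2 = t^2 ->
  square_triad a b c.
Proof.
  intros -> -> -> Hs Ht.
  split; [repeat split; eexists; reflexivity |].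
  split; [now exists s |].
  split; [exists t; rewrite <- Ht; ring | exists (x*y*z); ring].
Qed.

Theorem mainTheorem3 (m n : Z) :
  let R := m^4 - 6*m^2*n^2 + n^4 in
  let D := m^12 - 26*m^10*n^2 + 79*m^8*n^4 - 44*m^6*n^6
           + 79*m^4*n^8 - 26*m^2*n^10 + n^12 in
  let E := m^12 - 10*m^10*n^2 + 15*m^8*n^4 - 204*m^6*n^6
           + 15*m^4*n^8 - 10*m^2*n^10 + n^12 in
  square_triad ((m^4 - n^4)^2 * R^2)
               (4*m^2*n^2 * (m^2 + n^2)^2 * R^2)
               (64*m^4*n^4 * (m^2 - n^2)^4) /\
  square_triad (64*m^4*n^4 * (m^2 - n^2)^2)
               (16*m^2*n^2 * (m^2 - n^2)^4)
               ((m^2 + n^2)^2 * R^2) /\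
  square_triad (64*m^4*n^4 * (m^2 - n^2)^2 * D^2)
               ((m^2 + n^2)^2 * R^2 * D^2)
               (16*m^2*n^2 * (m^2 - n^2)^4 * E^2) /\
  square_triad ((m^4 - n^4)^2 * R^2 * E^2)
               (64*m^4*n^4 * (m^2 - n^2)^4 * E^2)
               (4*m^2*n^2 * (m^2 + n^2)^2 * R^2 * D^2).
Proof.
  intros R D E.
  set (P := m^2 - n^2); set (Q := 2*m*n); set (S := m^2 + n^2).
  (* F and G were found by extracting the square roots as polynomials in U, V. *)
  set (F := P^8 - 4*P^6*Q^2 + 10*P^4*Q^4 + Q^8).
  set (G := P^10 - P^8*Q^2 - 4*P^6*Q^4 + 8*P^4*Q^6 + 3*P^2*Q^8 + Q^10).
  split; [| split; [| split]].
  (* Here and in the next triad the witnesses come from [R^2 + 4P^2Q^2 = S^4] and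
     [S^4R^2 + 4P^4Q^4 = (P^4 + Q^4)^2]. *)
  - apply (square_triad_sqr (P*S*R) (Q*S*R) (2*P^2*Q^2) (P^4 + Q^4) (P*Q*S^4*R));
      unfold P, Q, S, R; ring.
  - apply (square_triad_sqr (2*P*Q^2) (2*P^2*Q) (S*R) (S^3) (2*P*Q*(P^4 + Q^4)));
      unfold P, Q, S, R; ring.
  (* Since [E - D = 4Q^2S^2R], [S^2] divides [4P^2Q^2(Q^2D^2 + P^2E^2)], hence the factor [S] in
     [S*F]. *)
  - apply (square_triad_sqr (2*P*Q^2*D) (S*R*D) (2*P^2*Q*E) (S*F) (2*P*Q*D*G));
      unfold F, G, P, Q, S, R, D, E; ring.
  (* The pairwise products of these roots are [P*Q*S*R*E] times the roots of triad (3), whose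
     squares sum to [(S*F)^2]. *)
  - apply (square_triad_sqr (P*S*R*E) (2*P^2*Q^2*E) (Q*S*R*D) G (P*Q*S^2*R*E*F));
      unfold F, G, P, Q, S, R, D, E; ring.
Qed.
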